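(* Let $S$ be a nonempty set. (1) (Duality) Let $z_0\in S^{S\times S}_{mn}$, and let $e\in S$ be the identity of the monoid $(S,z_0)$. Then there is a bijection $\phi$ from $S$ onto $S^*_{z_0}$ such that $\phi(e)=z_0$ and, for each $a\in S$, the semigroup $(S,\phi(a))$ is isomorphic to the semigroup $(S^*_{z_0},\hat{a})$ via $\phi$. In particular, $(S^*_{z_0},\hat{e})$ is a monoid with identity $z_0$. (2) Let $z_0\in S^{S\times S}_{gr}$, and let $e\in S$ be the identity of the group $(S,z_0)$. Then, in addition to the conclusions of (1), the following hold. (a) $S^*_{z_0}\subseteq S^{S\times S}_{gr}$, and for every $z\in S^*_{z_0}$ one has $S^*_z=S^*_{z_0}$ and the group $(S,z)$ is isomorphic to $(S,z_0)$ (hence, by (1), $(S,z)$ is also isomorphic to $(S^*_{z_0},\hat{a})$ for every $a\in S$). (b) Let $S^{S\times S}_{gr}(e)$ be the set of those $z\in S^{S\times S}_{gr}$ for which $e$ is the identity of the group $(S,z)$. Then $S^{S\times S}_{gr}$ is the disjoint union $S^{S\times S}_{gr}=\coprod\{S^*_z\,|\,z\in S^{S\times S}_{gr}(e)\}$; that is, the union of the sets $S^*_z$ over $z\in S^{S\times S}_{gr}(e)$ is $S^{S\times S}_{gr}$, and $S^*_{z}\cap S^*_{z'}=\emptyset$ for distinct $z,z'\in S^{S\times S}_{gr}(e)$. (c) For $z_1,z_2\in S^{S\times S}_{gr}(e)$ write $z_1\sim z_2$ if the groups $(S,z_1)$ and $(S,z_2)$ are isomorphic (an equivalence relation). Let $R=\{z_\lambda\,|\,\lambda\in\Lambda\}$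 be a complete set of representatives of the equivalence classes in $S^{S\times S}_{gr}(e)/{\sim}$ (exactly one representative $z_\lambda$ per class, indexed by a set $\Lambda$), and denote the equivalence class of $z_\lambda$ by $[z_\lambda]$. Then distinct elements of $R$ give distinct (i.e. non-isomorphic) group structures on $S$, and the elements of $R$ exhaust all possible group structures on $S$ (i.e. for every $z\in S^{S\times S}_{gr}$ the group $(S,z)$ is isomorphic to $(S,z_\lambda)$ for some $\lambda\in\Lambda$). In particular, if $S$ is finite, the number of distinct group structures on $S$ (up to isomorphism) is $|R|=|\Lambda|$. Furthermore, let $\operatorname{Sym}_e(S)$ be the group of permutations of $S$ that fix $e$, and for each $z_\lambda\in R$ let $\operatorname{Aut}(S,z_\lambda)$ be the group of automorphisms of $(S,z_\lambda)$, which is a subgroup of $\operatorname{Sym}_e(S)$. For $\sigma_1,\sigma_2\in\operatorname{Sym}_e(S)$ write $\sigma_1\sim_{z_\lambda}\sigma_2$ if $\sigma_2^{-1}\circ\sigma_1\in\operatorname{Aut}(S,z_\lambda)$, and let $\operatorname{Sym}_e(S)/\operatorname{Aut}(S,z_\lambda)$ be the set of equivalence classes of $\sim_{z_\lambda}$. Then for each $z_\lambda\in R$, $[z_\lambda]$ has the same cardinality as $\operatorname{Sym}_e(S)/\operatorname{Aut}(S,z_\lambda)$. In particular, if $|S|=n$ is a positive integer, then $|[z_\lambda]|=|S_{n-1}|/|\operatorname{Aut}(S,z_\lambda)|=(n-1)!/|\operatorname{Aut}(S,z_\lambda)|$, where $S_{n-1}$ is the symmetric group of degree $n-1$.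
   Context: For a set $S$, $S^{S\times S}$ denotes the set of all binary operations on $S$, i.e. all functions $S\times S\to S$. For $z\in S^{S\times S}$ and $a,b\in S$, $azb\in S$ denotes the image of $(a,b)$ under $z$, and $(S,z)$ denotes the set $S$ equipped with the operation $z$. $S^{S\times S}_{mn}$ (resp. $S^{S\times S}_{gr}$) is the set of $z\in S^{S\times S}$ for which $(S,z)$ is a monoid, i.e. associative with a two-sided identity (resp. a group). For $z\in S^{S\times S}$, the dual of $S$ with respect to $z$ is $$S^*_z:=\{z'\in S^{S\times S}\,|\,(azb)z'c=az(bz'c)\text{ and }(az'b)zc=az'(bzc)\ \ \forall a,b,c\in S\}.$$ Each $a\in S$ induces a binary operation $\hat{a}$ on $S^{S\times S}$: for $z_1,z_2\in S^{S\times S}$, $z_1\hat{a}z_2\in S^{S\times S}$ is defined by $$b(z_1\hat{a}z_2)c:=(bz_1a)z_2c\qquad\forall b,c\in S.$$ $(S^*_{z_0},\hat{a})$ denotes $S^*_{z_0}$ with the restriction of $\hat{a}$ (for $z_0\in S^{S\times S}_{mn}$, $S^*_{z_0}$ is closed under $\hat{a}$ and $(S^*_{z_0},\hat a)$ is a semigroup; also $S^*_{z_0}$ consists of associative operations). A homomorphism is a map between sets with binary operations that preserves the operations, an isomorphism is a bijective homomorphism, and an automorphism is an isomorphism of $(S,z)$ onto itself. *)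

(* Defs.v *)
From mathcomp Require Import all_boot perm.
From mathcomp Require Import boolp classical_sets functions cardinality.

Set Implicit Arguments.
Unset Strict Implicit.
Unset Printing Implicit Defensive.

Local Open Scope classical_set_scope.

Definition binop (T : Type) := T -> T -> T.

(* A set with a binary operation is a pair (A, op) with [A : set T] and
   [op : binop T] the ambient operation restricted to A, so closure of A under
   op is a condition.  The full type is the case A = [set: T]. *)
Section Structures.
Variables (T : Type) (A : set T) (op : binop T).

Definition is_identity (e : T) :=
  A e /\ forall x, A x -> op e x = x /\ op x e = x.

Definition is_semigroup :=
  (forall x y, A x -> A y -> A (op x y)) /\
  (forall x y z, A x -> A y -> A z -> op (op x y) z = op x (op y z)).

Definition is_monoid := is_semigroup /\ exists e, is_identity e.

Definition is_group :=
  is_semigroup /\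
  exists2 e, is_identity e &
    forall x, A x -> exists2 y, A y & op x y = e /\ op y x = e.

End Structures.

Definition is_hom (T U : Type) (A : set T) (opA : binop T)
    (B : set U) (opB : binop U) (f : T -> U) :=
  set_fun A B f /\
  forall x y, A x -> A y -> f (opA x y) = opB (f x) (f y).

Definition is_iso (T U : Type) (A : set T) (opA : binop T)
    (B : set U) (opB : binop U) (f : T -> U) :=
  is_hom A opA B opB f /\ set_bij A B f.

Definition isomorphic (T U : Type) (A : set T) (opA : binop T)
    (B : set U) (opB : binop U) :=
  exists f : T -> U, is_iso A opA B opB f.

Section Quotients.
Variables (T : Type) (A : set T) (r : T -> T -> Prop).

Definition equivalence_on :=
  [/\ forall x, A x -> r x x,
      forall x y, A x -> A y -> r x y -> r y x &
      forall x y z, A x -> A y -> A z -> r x y -> r y z -> r x z].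

Definition eqclass (x : T) : set T := [set y | A y /\ r y x].

Definition quotient_set : set (set T) := [set eqclass x | x in A].

Definition complete_representatives (R : set T) :=
  R `<=` A /\ forall C, quotient_set C -> exists! x, R x /\ C x.

End Quotients.

Section Duality.
Variable S : Type.
Implicit Types (z : binop S) (e a : S).

Definition monoid_ops : set (binop S) := [set z | is_monoid [set: S] z].

Definition group_ops : set (binop S) := [set z | is_group [set: S] z].

Definition group_ops_at e : set (binop S) :=
  [set z | group_ops z /\ is_identity [set: S] z e].

Definition dual z : set (binop S) :=
  [set z' : binop S | forall a b c,
     z' (z a b) c = z a (z' b c) /\ z (z' a b) c = z' a (z b c)].

Definition hat a : binop (binop S) :=
  fun z1 z2 : binop S => fun b c => z2 (z1 b a) c.

Definition iso_ops z1 z2 := isomorphic [set: S] z1 [set: S] z2.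

Definition duality z0 e :=
  (exists phi : S -> binop S,
     [/\ set_bij [set: S] (dual z0) phi,
         phi e = z0 &
         forall a, [/\ is_semigroup [set: S] (phi a),
                       is_semigroup (dual z0) (hat a) &
                       is_iso [set: S] (phi a) (dual z0) (hat a) phi]]) /\
  (is_monoid (dual z0) (hat e) /\ is_identity (dual z0) (hat e) z0).

Definition Sym_at e : set (S -> S) :=
  [set s | set_bij [set: S] [set: S] s /\ s e = e].

Definition Aut_ops z : set (S -> S) :=
  [set s | is_iso [set: S] z [set: S] z s].

Definition compose : binop (S -> S) := fun s t => s \o t.

(* [t] is the inverse of the permutation [s2]. *)
Definition coset_rel z (s1 s2 : S -> S) :=
  exists t : S -> S, [/\ cancel s2 t, cancel t s2 & Aut_ops z (t \o s1)].

End Duality.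

Arguments monoid_ops S : clear implicits.
Arguments group_ops S : clear implicits.
Arguments compose S : clear implicits.

(* Main.v *)
(* Evaluating the two dual identities at the identity e of z0 shows that every
   dual operation is a sandwich product x, y |-> x a y, and conversely; phi is
   a |-> (x, y |-> x a y).  When z0 is a group, right translation by a is an
   isomorphism from the sandwich product to z0, the relation "w is in the dual
   of z" is an equivalence between group operations, and each class contains
   exactly one operation with identity e, namely x, y |-> x e^-1 y.  The class
   of z_lambda is its orbit under the transport action of Sym_e(S), with
   stabiliser Aut(S, z_lambda), so the counting is the orbit-stabiliser
   theorem. *)

Require Import Defs.
From mathcomp Require Import all_boot perm.
From mathcomp Require Import boolp classical_sets functions cardinality.

Local Open Scope classical_set_scope.
Local Open Scope card_scope.

(** * Transport of algebraic structure along isomorphisms *)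

Section Isomorphisms.
Context {T U V : Type} {A : set T} {B : set U} {C : set V}.
Context {opA : binop T} {opB : binop U} {opC : binop V}.

Lemma is_isoTP (z : binop T) (z' : binop U) (f : T -> U) :
  is_iso [set: T] z [set: U] z' f <->
  bijective f /\ {morph f : x y / z x y >-> z' x y}.
Proof.
rewrite /is_iso setTT_bijective /is_hom; split=> [[[_ fM] bf]|[bf fM]].
  by split=> // x y; exact: fM.
by do 2!split=> //.
Qed.

Lemma is_iso_comp {f : T -> U} {g : U -> V} :
  is_iso A opA B opB f -> is_iso B opB C opC g -> is_iso A opA C opC (g \o f).
Proof.
move=> [[fAB fM] bf] [[gBC gM] bg]; split; last exact: set_bij_comp bg.
split=> [x Ax|x y Ax Ay] /=; first exact/gBC/fAB.
by rewrite fM// gM//; exact: fAB.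
Qed.

Lemma isomorphic_trans :
  isomorphic A opA B opB -> isomorphic B opB C opC -> isomorphic A opA C opC.
Proof. by move=> [f fi] [g gi]; exists (g \o f); exact: is_iso_comp gi. Qed.

Lemma is_identity_iso {f : T -> U} {e : T} :
  is_iso A opA B opB f -> is_identity A opA e -> is_identity B opB (f e).
Proof.
move=> [[fAB fM] [_ _ fsurj]] [Ae eP]; split; first exact: fAB.
move=> _ /fsurj[x Ax <-]; have [ex xe] := eP x Ax.
by rewrite -!fM// ex xe.
Qed.

Lemma is_semigroup_iso {f : T -> U} :
  is_iso A opA B opB f -> is_semigroup A opA -> is_semigroup B opB.
Proof.
move=> [[fAB fM] [_ _ fsurj]] [opAA opA_assoc]; split.
  move=> _ _ /fsurj[x Ax <-] /fsurj[y Ay <-].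
  by rewrite -fM//; exact/fAB/opAA.
move=> _ _ _ /fsurj[x Ax <-] /fsurj[y Ay <-] /fsurj[w Aw <-].
have Axy := opAA x y Ax Ay; have Ayw := opAA y w Ay Aw.
by rewrite -!fM// opA_assoc.
Qed.

Lemma is_group_iso {f : T -> U} :
  is_iso A opA B opB f -> is_group A opA -> is_group B opB.
Proof.
move=> fi [sA [e eid inv]]; split; first exact: is_semigroup_iso fi sA.
exists (f e); first exact: is_identity_iso fi eid.
move: fi => [[fAB fM] [_ _ fsurj]] _ /fsurj[x Ax <-].
have [y Ay [xy yx]] := inv x Ax.
by exists (f y); [exact: fAB|rewrite -!fM// xy yx].
Qed.

Lemma is_identity_unique {e e' : T} :
  is_identity A opA e -> is_identity A opA e' -> e = e'.
Proof.
move=> [Ae eP] [Ae' e'P].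
by have [<- _] := e'P e Ae; have [_ ->] := eP e' Ae'.
Qed.

End Isomorphisms.

(** * Isomorphism and duality as relations between operations on one type *)

Section OperationsOnAType.
Context {S : Type}.
Implicit Types (z w : binop S) (e : S).

Lemma iso_ops_refl z : iso_ops z z.
Proof. by exists id; apply/is_isoTP; split=> //; exists id. Qed.

Lemma iso_ops_sym {z w} : iso_ops z w -> iso_ops w z.
Proof.
move=> [f /is_isoTP[[g fK gK] fM]]; exists g; apply/is_isoTP.
split; first by exists f.
by move=> x y; apply: (can_inj fK); rewrite fM !gK.
Qed.

Lemma iso_ops_trans {z w v} : iso_ops z w -> iso_ops w v -> iso_ops z v.
Proof. exact: isomorphic_trans. Qed.

Lemma monoid_opsP {z e} :
  monoid_ops S z -> is_identity [set: S] z e ->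
  [/\ associative z, left_id e z & right_id e z].
Proof.
move=> [[_ zA] _] [_ eP]; split=> [a b c|a|a].
- by rewrite zA.
- by have [] := eP a I.
- by have [] := eP a I.
Qed.

Lemma group_monoid_ops {z} : group_ops S z -> monoid_ops S z.
Proof. by move=> [sz [e eid _]]; split=> //; exists e. Qed.

Lemma group_ops_inv {z e} : group_ops S z -> is_identity [set: S] z e ->
  forall x, exists y, z x y = e /\ z y x = e.
Proof.
move=> [_ [e' e'id inv]] eid x; rewrite (is_identity_unique eid e'id).
by have [y _ yP] := inv x I; exists y.
Qed.

(** The two defining identities trade places when [z] and [w] are exchanged. *)
Lemma dual_sym {z w} : dual z w -> dual w z.
Proof. by move=> zw a b c; have [-> ->] := zw a b c. Qed.

Lemma dual_refl {z} : is_semigroup [set: S] z -> dual z z.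
Proof. by move=> [_ zA] a b c; rewrite zA. Qed.

End OperationsOnAType.

(** * Duality for monoids through sandwich products *)

Definition sandwich {S : Type} (z : binop S) (a : S) : binop S :=
  fun x y => z (z x a) y.

Section Sandwich.
Context {S : Type} {z : binop S} {e : S}.
Hypotheses (zmn : monoid_ops S z) (eid : is_identity [set: S] z e).

Let zA : associative z. Proof. by case: (monoid_opsP zmn eid). Qed.
Let z1l : left_id e z. Proof. by case: (monoid_opsP zmn eid). Qed.
Let z1r : right_id e z. Proof. by case: (monoid_opsP zmn eid). Qed.

Lemma dual_sandwich a : dual z (sandwich z a).
Proof. by move=> x y w; rewrite /sandwich !zA. Qed.

Lemma sandwich_id : sandwich z e = z.
Proof. by apply/funext=> x; rewrite /sandwich z1r. Qed.

Lemma dualE {w} : dual z w -> w = sandwich z (w e e).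
Proof.
move=> zw; apply/funext=> x; apply/funext=> y; rewrite /sandwich.
(* [h] splits [y] off [w e y] on the right and [h'] splits [x] off [w x y] on the left, which leaves
   [w e e] in the middle. *)
have [_ h] := zw e e y; have [h' _] := zw x e y.
by rewrite -zA h z1l -h' z1r.
Qed.

Lemma sandwich_bij : set_bij [set: S] (dual z) (sandwich z).
Proof.
split=> [a _|a b _ _ ab|w zw]; first exact: dual_sandwich.
  by have := congr1 (fun w : binop S => w e e) ab; rewrite /sandwich !z1l !z1r.
by exists (w e e) => //; rewrite -dualE.
Qed.

Lemma sandwich_semigroup a : is_semigroup [set: S] (sandwich z a).
Proof. by split=> // x y w _ _ _; rewrite /sandwich !zA. Qed.

(** Both sides of the morphism law send [b], [c] to the [z]-product b x a y c, up to bracketing. *)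
Lemma sandwich_iso a :
  is_iso [set: S] (sandwich z a) (dual z) (hat a) (sandwich z).
Proof.
split; last exact: sandwich_bij.
split=> [b _|x y _ _]; first exact: dual_sandwich.
by apply/funext=> b; apply/funext=> c; rewrite /hat /sandwich !zA.
Qed.

Lemma monoid_duality : duality z e.
Proof.
have idz : is_identity (dual z) (hat e) z.
  (* [sandwich_id] serves twice: it presents [z] as the image of [e], and it turns the source
     operation [sandwich z e] back into [z], whose identity is [e]. *)
  rewrite -[X in is_identity _ _ X]sandwich_id.
  by apply: is_identity_iso (sandwich_iso e) _; rewrite sandwich_id.
have semi a := is_semigroup_iso (sandwich_iso a) (sandwich_semigroup a).
split; last by split=> //; split=> //; exists z.
exists (sandwich z); split; [exact: sandwich_bij|exact: sandwich_id|move=> a].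
by split=> //; [exact: sandwich_semigroup|exact: sandwich_iso].
Qed.

(* Any two members of the dual are sandwich operations of the same semigroup,
   hence dual to each other. *)
Lemma dual_sub {w} : dual z w -> dual z `<=` dual w.
Proof.
move=> /dualE-> v /dualE->.
by move=> a b c; rewrite /sandwich !zA.
Qed.

End Sandwich.

(** * Duals of group operations and the partition they form *)

Section GroupDual.
Context {S : Type}.
Implicit Types (z w : binop S) (e : S).

(* Right translation by [a] carries [x a y] to [(x a) (y a)]. *)
Lemma sandwich_iso_ops {z} a : group_ops S z -> iso_ops (sandwich z a) z.
Proof.
move=> zgr; have [_ [e eid _]] := zgr.
have [zA z1l z1r] := monoid_opsP (group_monoid_ops zgr) eid.
have [b [ab ba]] := group_ops_inv zgr eid a.
exists (fun x => z x a); apply/is_isoTP; split.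
  by exists (fun x => z x b) => x; rewrite -zA ?ab ?ba z1r.
by move=> x y; rewrite /sandwich !zA.
Qed.

Lemma iso_ops_group {z w} : group_ops S z -> iso_ops z w -> group_ops S w.
Proof. by move=> zgr [f fi]; exact: is_group_iso fi zgr. Qed.

Lemma dual_iso_ops {z w} : group_ops S z -> dual z w -> iso_ops w z.
Proof.
move=> zgr; have [_ [e eid _]] := zgr.
by move=> /(dualE (group_monoid_ops zgr) eid)->; exact: sandwich_iso_ops.
Qed.

Lemma dual_group {z w} : group_ops S z -> dual z w -> group_ops S w.
Proof.
by move=> zgr zw; apply: iso_ops_group zgr (iso_ops_sym (dual_iso_ops zgr zw)).
Qed.

(** Since [w] is again a group operation and duality is symmetric, [dual_sub] applies in both
    directions. *)
Lemma dual_eq {z w} : group_ops S z -> dual z w -> dual w = dual z.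
Proof.
move=> zgr zw; have wgr := dual_group zgr zw.
have [[_ [e eid _]] [_ [e' eid' _]]] := (zgr, wgr).
rewrite eqEsubset; split.
  exact: dual_sub (group_monoid_ops wgr) eid' _ (dual_sym zw).
exact: dual_sub (group_monoid_ops zgr) eid _ zw.
Qed.

(** The isomorphism is composed through [z] and [sandwich z a], the latter being the operation that
    the duality map matches with [hat a]. *)
Lemma iso_ops_hat {z w} a : group_ops S z -> dual z w ->
  isomorphic [set: S] w (dual z) (hat a).
Proof.
move=> zgr zw; apply: isomorphic_trans (dual_iso_ops zgr zw) _.
apply: isomorphic_trans (iso_ops_sym (sandwich_iso_ops a zgr)) _.
have [_ [e eid _]] := zgr.
by exists (sandwich z); exact: sandwich_iso (group_monoid_ops zgr) eid a.
Qed.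

(* The witness is [x, y |-> x e^-1 y]. *)
Lemma dual_group_ops_at e {w} : group_ops S w ->
  exists2 z, group_ops_at e z & dual z w.
Proof.
move=> wgr; have [_ [u uid _]] := wgr.
have [wA w1l w1r] := monoid_opsP (group_monoid_ops wgr) uid.
have [t [et te]] := group_ops_inv wgr uid e.
have wt := dual_sandwich (group_monoid_ops wgr) uid t.
exists (sandwich w t); last exact: dual_sym.
split; first exact: dual_group wgr wt.
by split=> // x _; rewrite /sandwich et -wA te w1l w1r.
Qed.

Lemma bigcup_dual e : \bigcup_(z in group_ops_at e) dual z = group_ops S.
Proof.
rewrite eqEsubset; split=> [w [z [zgr _]]|w wgr]; first exact: dual_group.
by have [z zat zw] := dual_group_ops_at e wgr; exists z.
Qed.

Lemma dual_disjoint {e z w} : group_ops_at e z -> group_ops_at e w -> z <> w ->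
  dual z `&` dual w = set0.
Proof.
move=> [zgr zid] [wgr wid] zw; rewrite -subset0 => v [zv wv]; apply: zw.
(* A common member [v] forces the duals of [z], [v] and [w] to coincide, and [w] lies in its own
   dual. *)
have : dual z w.
  rewrite -(dual_eq zgr zv) (dual_eq wgr wv); apply: dual_refl.
  by case: wgr.
(* The middle factor [w e e] is [e], because [e] is also the identity of [w]. *)
move=> /(dualE (group_monoid_ops zgr) zid)->.
have [_ w1l _] := monoid_opsP (group_monoid_ops wgr) wid.
by rewrite w1l (sandwich_id (group_monoid_ops zgr) zid).
Qed.

End GroupDual.

(** * The transport action of permutations on operations *)

Section Conjugation.
Context {S : Type}.
Implicit Types (z w : binop S) (e : S) (s t : S -> S).

(* The identity if [s] is not bijective. *)
Definition inverse s : S -> S :=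
  if pselect (exists t, cancel s t /\ cancel t s) is left st then sval (cid st)
  else id.

Lemma inverseP {s} : bijective s ->
  cancel s (inverse s) /\ cancel (inverse s) s.
Proof.
move=> [t sK tK]; rewrite /inverse; case: pselect => [st|]; first by case: cid.
by case; exists t.
Qed.

Definition conj_op z s : binop S :=
  fun x y => s (z (inverse s x) (inverse s y)).

(** Turns isomorphism questions into equations: a bijective [s] is an isomorphism from [z] onto
    exactly one operation, the transported one. *)
Lemma is_iso_conj z w s :
  is_iso [set: S] z [set: S] w s <-> bijective s /\ conj_op z s = w.
Proof.
rewrite is_isoTP; split=> -[bs]; have [sK tK] := inverseP bs.
  move=> sM; split=> //; apply/funext=> x; apply/funext=> y.
  by rewrite /conj_op sM !tK.
by move=> <-; split=> // x y; rewrite /conj_op !sK.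
Qed.

Lemma Sym_at_bij {e s} : Sym_at e s -> bijective s.
Proof. by move=> [+ _]; rewrite setTT_bijective. Qed.

Lemma Sym_at_comp {e s t} : Sym_at e s -> Sym_at e t -> Sym_at e (s \o t).
Proof.
move=> [bs se] [bt te]; split; first exact: set_bij_comp bs.
by rewrite /= te se.
Qed.

Lemma Sym_at_inverse {e s t} : cancel s t -> cancel t s ->
  Sym_at e s -> Sym_at e t.
Proof.
move=> sK tK [_ se]; split; last by rewrite -{1}se sK.
by rewrite setTT_bijective; exists s.
Qed.

Lemma Sym_at_group e : is_group (Sym_at e) (compose S).
Proof.
have id_sym : Sym_at e id by split=> //; rewrite setTT_bijective; exists id.
split; first by split=> // s t; exact: Sym_at_comp.
exists id => // s ses; have [t sK tK] := Sym_at_bij ses.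
exists t; first exact: Sym_at_inverse ses.
by split; apply/funext.
Qed.

Lemma Aut_ops_group z : is_group (Aut_ops z) (compose S).
Proof.
have id_aut : Aut_ops z id by apply/is_isoTP; split=> //; exists id.
split.
  by split=> // s t sz tz; exact: is_iso_comp tz sz.
exists id => // s /is_isoTP[[t sK tK] sM].
exists t; last by split; apply/funext.
apply/is_isoTP; split; first by exists s.
by move=> x y; apply: (can_inj sK); rewrite sM !tK.
Qed.

(** Isomorphisms carry identities to identities, so uniqueness of the identity of [w] makes [s] fix
    [e]. *)
Lemma iso_ops_identity {z w e s} : is_identity [set: S] z e ->
  is_identity [set: S] w e -> is_iso [set: S] z [set: S] w s -> Sym_at e s.
Proof.
move=> zid wid si; split; first by case: si.
exact: is_identity_unique (is_identity_iso si zid) wid.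
Qed.

Lemma Aut_ops_sub_Sym_at {z e} : is_identity [set: S] z e ->
  Aut_ops z `<=` Sym_at e.
Proof. by move=> zid s; exact: iso_ops_identity. Qed.

(** Cosets of the stabiliser correspond to points of the orbit: [s] and [t] are isomorphisms onto
    their transports of [z], so these agree exactly when t^-1 s is an automorphism of [z]. *)
Lemma coset_relE z s t : bijective s -> bijective t ->
  coset_rel z s t <-> conj_op z s = conj_op z t.
Proof.
move=> bs bt.
have /is_isoTP[_ tM] : is_iso [set: S] z [set: S] (conj_op z t) t.
  exact/is_iso_conj.
have /is_isoTP[_ sM] : is_iso [set: S] z [set: S] (conj_op z s) s.
  exact/is_iso_conj.
split=> [[t' [tK t'K /is_isoTP[bts tsM]]]|st].
  suff /is_iso_conj[] : is_iso [set: S] z [set: S] (conj_op z t) s by [].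
  apply/is_isoTP; split=> // x y.
  apply: (can_inj t'K); rewrite [LHS]tsM /=.
  by rewrite -[in RHS](t'K (s x)) -[in RHS](t'K (s y)) -tM tK.
have [t' tK t'K] := bt.
exists t'; split=> //; apply/is_isoTP; split.
  by apply: bij_comp bs; exists t.
by move=> x y /=; apply: (can_inj tK); rewrite t'K tM !t'K sM st.
Qed.

(** By [coset_relE] the relation is the kernel of [conj_op z], so it inherits the laws of
    equality. *)
Lemma coset_rel_equivalence z e : equivalence_on (Sym_at e) (coset_rel z).
Proof.
have E s t : Sym_at e s -> Sym_at e t ->
    coset_rel z s t <-> conj_op z s = conj_op z t.
  by move=> /Sym_at_bij bs /Sym_at_bij bt; exact: coset_relE.
split=> [s es|s t es et|s t r es et er]; first exact/E.
  by move=> /E st; apply/E=> //; rewrite st.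
by move=> /E st /E tr; apply/E=> //; rewrite st// tr.
Qed.

Lemma eqclass_conj {z e} : group_ops_at e z ->
  eqclass (group_ops_at e) (@iso_ops S) z = conj_op z @` Sym_at e.
Proof.
move=> [zgr zid]; rewrite eqEsubset; split=> [w [[wgr wid]]|_ [s es <-]].
  move=> /iso_ops_sym[s si]; exists s; first exact: iso_ops_identity si.
  by have /is_iso_conj[] := si.
have si : is_iso [set: S] z [set: S] (conj_op z s) s.
  by apply/is_iso_conj; split=> //; exact: Sym_at_bij es.
split; last by apply: iso_ops_sym; exists s.
split; first exact: is_group_iso si zgr.
have [_ <-] := es; exact: is_identity_iso si zid.
Qed.

End Conjugation.

(** * Cardinalities of quotients, finite predicates and products *)

Lemma set_bij_card {T U : Type} {A : set T} {B : set U} {f : T -> U} :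
  set_bij A B f -> A #= B.
Proof. by move=> fb; apply: pcard_eq; exact: fb. Qed.

Lemma equivalence_eqclass {T : Type} {A : set T} {r : T -> T -> Prop} {x y} :
  equivalence_on A r -> A x -> A y -> eqclass A r x = eqclass A r y <-> r x y.
Proof.
move=> [rr rs rt] Ax Ay; split=> [xy|rxy].
  have xx : eqclass A r x x by split=> //; exact: rr.
  by move: xx; rewrite xy => -[].
rewrite eqEsubset; split=> v [Av rv]; split=> //; first exact: rt rxy.
by apply: rt rv (rs _ _ _ _ rxy).
Qed.

(** The classes of [r] are the nonempty fibres of [f] on [A], so taking the fibre over a value is
    the bijection. *)
Lemma card_quotient_image {T U : Type} {A : set T} {r : T -> T -> Prop}
    {f : T -> U} :
  (forall x y, A x -> A y -> r x y <-> f x = f y) ->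
  f @` A #= quotient_set A r.
Proof.
move=> rf.
have fibre x : A x -> eqclass A r x = A `&` f @^-1` [set f x].
  move=> Ax; rewrite eqEsubset; split=> y [Ay] => [/rf yx|yx].
    by split=> //; exact: yx.
  by split=> //; apply/rf.
apply: (@set_bij_card _ _ _ _ (fun u => A `&` f @^-1` [set u])).
split=> [_ [x Ax <-]|u v|_ [x Ax <-]].
- by exists x => //; exact: fibre.
- rewrite !inE => -[x Ax <-] [y Ay <-] xy.
  have xx : (A `&` f @^-1` [set f x]) x by [].
  by move: xx; rewrite xy => -[].
- by exists (f x); [exists x|rewrite fibre].
Qed.

Lemma card_finpred {T : finType} (P : {pred T}) : [set x | x \in P] #= `I_#|P|.
Proof.
apply: (@set_bij_card _ _ _ _ (fun x => index x (enum P))).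
split=> [x /= Px|x y|i /= ltiP].
- by rewrite cardE index_mem mem_enum.
- rewrite !inE => Px Py ij.
  have xP : x \in enum P by rewrite mem_enum.
  by rewrite -(nth_index x xP) ij nth_index// mem_enum.
(* Only a default value for [nth]; the index [i] is in range. *)
- have x0 := enum_val (Ordinal ltiP).
  have ltiE : i < size (enum P) by rewrite -cardE.
  exists (nth x0 (enum P) i); last by rewrite index_uniq// enum_uniq.
  by rewrite /= -mem_enum mem_nth.
Qed.

(** Pairs are coded as [f x * n + g y] and decoded by Euclidean division by [n]. *)
Lemma card_setX {T U : Type} {A : set T} {B : set U} {m n : nat} :
  A #= `I_m -> B #= `I_n -> A `*` B #= `I_(m * n).
Proof.
move=> /card_set_bijP[f [fA finj fsurj]] /card_set_bijP[g [gB ginj gsurj]].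
apply: (@set_bij_card _ _ _ _ (fun p => f p.1 * n + g p.2)).
have div q j : j < n -> ((q * n + j) %/ n = q) * ((q * n + j) %% n = j).
  move=> ltjn; have n_gt0 : 0 < n by exact: leq_ltn_trans ltjn.
  by rewrite divnMDl// divn_small// addn0 modnMDl modn_small.
split=> [[x y] [/= Ax By]|[x y] [x' y']|i /= ltimn].
- have /= fx := fA x Ax; have /= gy := gB y By.
  apply: (@leq_trans ((f x).+1 * n)); last by rewrite leq_mul2r fx orbT.
  by rewrite mulSn addnC ltn_add2r.
- rewrite !inE => -[/= Ax By] [/= Ax' By'] E.
  have /= gy := gB y By; have /= gy' := gB y' By'.
  have := congr1 (divn^~ n) E; have := congr1 (modn^~ n) E.
  rewrite !div// => gE fE.
  by rewrite (finj x x') ?inE// (ginj y y') ?inE.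
- have n_gt0 : 0 < n by case: n ltimn {gB gsurj div}; rewrite ?muln0.
  have [x Ax fx] : (f @` A) (i %/ n) by apply: fsurj; rewrite /= ltn_divLR.
  have [y By gy] : (g @` B) (i %% n) by apply: gsurj; rewrite /= ltn_mod.
  by exists (x, y) => //=; rewrite fx gy -divn_eq.
Qed.

(** * Counting permutations and orbits *)

Section FiniteCarrier.
Context {S : Type}.

Lemma bijective_ord {n : nat} : [set: S] #= `I_n ->
  exists f : S -> 'I_n, bijective f.
Proof.
move=> /card_set_bijP[f [fn finj fsurj]].
exists (fun x => Ordinal (fn x I)); rewrite -setTT_bijective.
split=> // [x y _ _ /(congr1 val) /= xy|i _].
  by apply: finj; rewrite ?inE.
by have [x _ xi] := fsurj i (ltn_ord i); exists x => //; exact: val_inj.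
Qed.

(** Every operation is read off from a multiplication table on ['I_n], and the tables form a finite
    type. *)
Lemma finite_binop : finite_set [set: S] -> finite_set [set: binop S].
Proof.
move=> [n /bijective_ord[f [g fK gK]]].
pose F (h : {ffun 'I_n * 'I_n -> 'I_n}) : binop S :=
  fun x y => g (h (f x, f y)).
suff <- : F @` [set: {ffun 'I_n * 'I_n -> 'I_n}] = [set: binop S].
  exact/finite_image/finite_finset.
rewrite -subTset => z _; exists [ffun p => f (z (g p.1) (g p.2))] => //.
by apply/funext=> x; apply/funext=> y; rewrite /F ffunE /= !fK.
Qed.

Lemma card_Sym_at {n : nat} (e : S) :
  [set: S] #= `I_n -> Sym_at e #= `I_((n.-1)`!).
Proof.
move=> /bijective_ord[f [g fK gK]].
(* Permutations of ['I_n] supported off the point [f e] are those that fix it; the support has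
   [n.-1] points available. *)
have <- : #|perm_on [set~ f e]%SET| = (n.-1)`!.
  by rewrite card_perm cardsC1 card_ord.
apply: card_eq_trans (card_esym _) (card_finpred _).
apply: (@set_bij_card _ _ _ _ (fun s : 'S_n => g \o s \o f)).
have fix_fe (s : 'S_n) : s \in perm_on [set~ f e]%SET <-> s (f e) = f e.
  split=> [/out_perm->|sfe]; rewrite ?inE ?eqxx//.
  apply/fintype.subsetP=> i; rewrite !inE; apply: contra_neq => ->; exact: sfe.
split=> [s /= /fix_fe sfe|s t _ _ st|s es].
- split; last by rewrite /= sfe fK.
  rewrite setTT_bijective; exists (g \o (s^-1)%g \o f) => x /=.
    by rewrite gK permK fK.
  by rewrite gK permKV fK.
- apply/permP=> i; apply: (can_inj gK).
  by have := congr1 (fun h => h (g i)) st; rewrite /= gK.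
- have [t sK tK] := Sym_at_bij es.
  have inj : injective (f \o s \o g).
    by move=> i j /(can_inj fK)/(can_inj sK)/(can_inj gK).
  exists (perm inj); first by apply/fix_fe; rewrite permE /= fK es.2.
  by apply/funext=> x /=; rewrite permE /= !fK.
Qed.

(* Lagrange: choosing [s] with [conj_op z s = w] for each [w] in the orbit of
   [z] identifies [Sym_at e] with the orbit times the stabiliser [Aut_ops z]. *)
Lemma card_orbit_Aut {z : binop S} {e : S} : is_identity [set: S] z e ->
  (conj_op z @` Sym_at e) `*` Aut_ops z #= Sym_at e.
Proof.
move=> zid.
have [w|sec secP] := @choice _ _ (fun w s =>
    (conj_op z @` Sym_at e) w -> Sym_at e s /\ conj_op z s = w).
  have [[s es sw]|nw] := pselect ((conj_op z @` Sym_at e) w).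
    by exists s.
  by exists id.
have iso_sec w : (conj_op z @` Sym_at e) w ->
    is_iso [set: S] z [set: S] w (sec w).
  by move=> /secP[/Sym_at_bij bs sw]; apply/is_iso_conj.
apply: (@set_bij_card _ _ _ _ (fun p => sec p.1 \o p.2)).
split=> [[w s] [/= ww zs]|[w s] [v t]|s es].
- have es := Aut_ops_sub_Sym_at zid _ zs.
  exact: Sym_at_comp (secP w ww).1 es.
- rewrite !inE => -[/= ww zs] [/= vv zt] st.
  (* Precomposing [sec w] with an automorphism of [z] still gives an isomorphism from [z] to [w], so
     the composite determines [w]. *)
  have wv : w = v.
    have /is_iso_conj[_ <-] := is_iso_comp zs (iso_sec w ww).
    by rewrite st; have /is_iso_conj[] := is_iso_comp zt (iso_sec v vv).
  have [r rK _] := Sym_at_bij (secP w ww).1.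
  rewrite -wv in st *; congr pair; apply/funext=> x; apply: (can_inj rK).
  by have := congr1 (fun h => h x) st.
- have ww : (conj_op z @` Sym_at e) (conj_op z s) by exists s.
  have [er er_conj] := secP _ ww; have br := Sym_at_bij er.
  have /(coset_relE z _ _ (Sym_at_bij es) br)[r [rK r'K zr]] := esym er_conj.
  by exists (conj_op z s, r \o s) => //; apply/funext=> x /=; rewrite r'K.
Qed.

End FiniteCarrier.

(** * Representatives of the isomorphism classes *)

Section Representatives.
Context {S : Type} {e : S} {R : set (binop S)}.
Hypothesis R_repr : complete_representatives (group_ops_at e) (@iso_ops S) R.
Implicit Types (z w : binop S).

Lemma iso_ops_equivalence (A : set (binop S)) : equivalence_on A (@iso_ops S).
Proof.
split=> [z _|z w _ _|z w v _ _ _]; first exact: iso_ops_refl.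
  exact: iso_ops_sym.
exact: iso_ops_trans.
Qed.

Lemma representatives_iso z w : R z -> R w -> iso_ops z w -> z = w.
Proof.
move=> Rz Rw zw.
have [RA /(_ (eqclass (group_ops_at e) (@iso_ops S) w))] := R_repr.
case; first by exists w => //; exact: RA.
(* Both [z] and [w] are representatives lying in the class of [w]. *)
move=> v [_ vuniq]; rewrite -(vuniq z) ?(vuniq w)//; split=> //; split=> //.
- exact: RA.
- exact: iso_ops_refl.
- exact: RA.
Qed.

(** The identity of [z] may differ from [e]; the dual containing [z] supplies an isomorphic group
    operation with identity [e], which has a representative. *)
Lemma representatives_exhaust z : group_ops S z -> exists2 w, R w & iso_ops z w.
Proof.
move=> /(dual_group_ops_at e)[v vat vz].
have [_ /(_ (eqclass (group_ops_at e) (@iso_ops S) v))[]] := R_repr.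
  by exists v.
move=> w [[Rw [_ wv]] _]; exists w => //.
exact: iso_ops_trans (dual_iso_ops vat.1 vz) (iso_ops_sym wv).
Qed.

(** The classes here range over group operations with any identity, so surjectivity rests on
    [representatives_exhaust]. *)
Lemma card_representatives : R #= quotient_set (group_ops S) (@iso_ops S).
Proof.
have RS z : R z -> group_ops S z by have [RA _] := R_repr => /RA[].
have classE z w := @equivalence_eqclass _ (group_ops S) _ z w
  (iso_ops_equivalence _).
apply: (@set_bij_card _ _ _ _ (eqclass (group_ops S) (@iso_ops S))).
split=> [z /RS zgr|z w|_ [z zgr <-]]; first by exists z.
  rewrite !inE => Rz Rw /classE zw.
  by apply: representatives_iso => //; apply: zw; exact: RS.
have [w Rw zw] := representatives_exhaust z zgr.
by exists w => //; apply/classE => //; [exact: RS|exact: iso_ops_sym].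
Qed.

End Representatives.

Theorem theorem2p3 (S : Type) (S_nonempty : inhabited S) :
  (* (1) *)
  (forall (z0 : binop S) (e : S),
     monoid_ops S z0 -> is_identity [set: S] z0 e -> duality z0 e) /\
  (* (2) *)
  (forall (z0 : binop S) (e : S),
     group_ops S z0 -> is_identity [set: S] z0 e ->
     duality z0 e /\
     (* (a) *)
     (dual z0 `<=` group_ops S /\
      forall z : binop S, dual z0 z ->
        [/\ dual z = dual z0,
            iso_ops z z0 &
            forall a : S, isomorphic [set: S] z (dual z0) (hat a)]) /\
     (* (b) *)
     (\bigcup_(z in group_ops_at e) dual z = group_ops S /\
      forall z z' : binop S, group_ops_at e z -> group_ops_at e z' ->
        z <> z' -> dual z `&` dual z' = set0) /\
     (* (c) *)
     (equivalence_on (group_ops_at e) (@iso_ops S) /\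
      forall (R : set (binop S)) (Lambda : Type) (zl : Lambda -> binop S),
        complete_representatives (group_ops_at e) (@iso_ops S) R ->
        set_bij [set: Lambda] R zl ->
        (forall z z' : binop S, R z -> R z' -> z <> z' -> ~ iso_ops z z') /\
        (forall z : binop S, group_ops S z -> exists l, iso_ops z (zl l)) /\
        (finite_set [set: S] ->
           exists k : nat,
             [/\ quotient_set (group_ops S) (@iso_ops S) #= `I_k,
                 R #= `I_k &
                 [set: Lambda] #= `I_k]) /\
        is_group (Sym_at e) (compose S) /\
        (forall l : Lambda,
           [/\ is_group (Aut_ops (zl l)) (compose S),
               Aut_ops (zl l) `<=` Sym_at e,
               equivalence_on (Sym_at e) (coset_rel (zl l)) &
               eqclass (group_ops_at e) (@iso_ops S) (zl l)
                 #= quotient_set (Sym_at e) (coset_rel (zl l))] /\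
           (forall n : nat, 0 < n -> [set: S] #= `I_n ->
              exists m : nat,
                [/\ Aut_ops (zl l) #= `I_m,
                    m %| (n.-1)`!,
                    eqclass (group_ops_at e) (@iso_ops S) (zl l)
                      #= `I_(#|'S_(n.-1)| %/ m) &
                    #|'S_(n.-1)| %/ m = (n.-1)`! %/ m])))).
Proof.
split=> [z0 e|z0 e z0gr z0id]; first exact: monoid_duality.
split; first exact: monoid_duality (group_monoid_ops z0gr) z0id.
split.
  split=> [z|z z0z]; first exact: dual_group.
  split; [exact: dual_eq|exact: dual_iso_ops|].
  by move=> a; exact: iso_ops_hat.
split; first by split=> [|z z']; [exact: bigcup_dual|exact: dual_disjoint].
split=> [|R Lambda zl R_repr zl_bij]; first exact: iso_ops_equivalence.
have [zlR _ zl_surj] := zl_bij; have [RA _] := R_repr.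
have Lambda_R := set_bij_card zl_bij.
split; first by move=> z z' Rz Rz' zz' /(representatives_iso R_repr z z' Rz Rz').
split.
  move=> z /(representatives_exhaust R_repr)[w /zl_surj[l _ <-] zw].
  by exists l.
split.
  move=> /finite_binop/(sub_finite_set (@subsetT _ R))[k Rk]; exists k.
  split=> //; last exact: card_eq_trans Lambda_R Rk.
  exact: card_eq_trans (card_esym (card_representatives R_repr)) Rk.
split=> [|l]; first exact: Sym_at_group.
have zl_at := RA _ (zlR l I); have zl_id := zl_at.2.
(* With the class written as an orbit, [conj_op (zl l)] compares it with the cosets and also serves
   the count. *)
rewrite (eqclass_conj zl_at); split.
  split; [exact: Aut_ops_group|exact: Aut_ops_sub_Sym_at|
    exact: coset_rel_equivalence|].
  apply: card_quotient_image => s t /Sym_at_bij bs /Sym_at_bij bt.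
  exact: coset_relE.
move=> n _ Sn; have Symn := card_Sym_at e Sn.
have Symf : finite_set (Sym_at e) by exists (n.-1)`!.
have [m Autm] := sub_finite_set (Aut_ops_sub_Sym_at zl_id) Symf.
have [k orbk] := finite_image (conj_op (zl l)) Symf.
(* Orbit size times stabiliser order, both sides counting [Sym_at e]. *)
have km : k * m = (n.-1)`!.
  apply/card_eq_II; apply: card_eq_trans Symn.
  apply: card_eq_trans (card_orbit_Aut zl_id).
  exact/card_esym/card_setX.
(* Positivity allows [m] to be cancelled in [k * m %/ m]. *)
have m_gt0 : 0 < m.
  by have := fact_gt0 n.-1; rewrite -km muln_gt0 => /andP[].
by exists m; rewrite card_Sn -km dvdn_mull// mulnK.
Qed.
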